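(* Let $S\in\Delta^1_n$ contain a pair of symmetric arcs $(u,v)$ and $(v,u)$, and let $S'$ be the sidigraph obtained from $S$ by deleting one of these two arcs. Then $E(S')<E(S)$.
   Context: A sidigraph is a digraph (no loops, at most one arc from $u$ to $v$) with a sign $\pm1$ on each arc; its eigenvalues are those of its adjacency matrix, whose $(i,j)$ entry is the sign of the arc from $v_i$ to $v_j$ if it exists and $0$ otherwise. The energy of a sidigraph with eigenvalues $z_1,\dots,z_n$ is $E(S)=\sum_{j=1}^n|\Re z_j|$. The sign of a directed cycle is the product of its arc signs. $\Delta^1_n$ is the class of sidigraphs on $n$ vertices whose underlying digraph is bipartite and in which every directed cycle of length $\equiv 0\pmod 4$ is negative and every directed cycle of length $\equiv 2\pmod 4$ is positive. *)

(* Defs.v *)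
From HB Require Import structures.
From mathcomp Require Import all_boot all_order all_algebra all_field.
Set Implicit Arguments. Unset Strict Implicit. Unset Printing Implicit Defensive.
Import Order.TTheory GRing.Theory Num.Theory.
Local Open Scope ring_scope.

(* A sidigraph on vertex set 'I_n is given by its adjacency matrix:
   entries in {-1,0,1}, zero diagonal (no loops); A i j = sign of arc i->j,
   or 0 if there is no arc. *)
Definition is_sidigraph (n : nat) (A : 'M[int]_n) : Prop :=
  (forall i j, A i j \in [:: -1; 0; 1]) /\ (forall i, A i i = 0).

Definition sd_arc (n : nat) (A : 'M[int]_n) (i j : 'I_n) : bool := A i j != 0.

Definition bipartite_sd (n : nat) (A : 'M[int]_n) : Prop :=
  exists c : 'I_n -> bool, forall i j, sd_arc A i j -> c i != c j.

Definition cyc_pairs (n : nat) (s : seq 'I_n) : seq ('I_n * 'I_n) :=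
  zip s (rot 1 s).

Definition dcycle (n : nat) (A : 'M[int]_n) (s : seq 'I_n) : bool :=
  [&& 2 <= size s, uniq s & all (fun p => sd_arc A p.1 p.2) (cyc_pairs s)]%N.

Definition cycle_sign (n : nat) (A : 'M[int]_n) (s : seq 'I_n) : int :=
  \prod_(p <- cyc_pairs s) A p.1 p.2.

Definition Delta1 (n : nat) (A : 'M[int]_n) : Prop :=
  is_sidigraph A /\ bipartite_sd A /\
  (forall s, dcycle A s ->
     ((size s %% 4 == 0)%N -> cycle_sign A s = -1) /\
     ((size s %% 4 == 2)%N -> cycle_sign A s = 1)).

Definition sd_eigenvalues (n : nat) (A : 'M[int]_n) : seq algC :=
  sval (closed_field_poly_normal (char_poly (map_mx (fun z : int => z%:~R) A))).

Definition sd_energy (n : nat) (A : 'M[int]_n) : algC :=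
  \sum_(z <- sd_eigenvalues A) `|'Re z|.

Definition delete_arc (n : nat) (A : 'M[int]_n) (u v : 'I_n) : 'M[int]_n :=
  \matrix_(i, j) if (i == u) && (j == v) then 0 else A i j.

(* Main.v *)
Require Import Defs.
From HB Require Import structures.
From mathcomp Require Import all_boot all_order all_algebra all_fingroup.
From mathcomp Require Import all_field ring.
Set Implicit Arguments.
Unset Strict Implicit.
Unset Printing Implicit Defensive.
Import Order.TTheory GRing.Theory Num.Theory.
Local Open Scope ring_scope.

(* In the expansion of [det (i y - A)] over permutations, the sign conditions
   make every nonzero term equal to [i^n y^f], where [f] is the number of fixed
   points.  Deleting an arc of a 2-cycle therefore lowers the modulus of the
   characteristic polynomial at [i x] by at least [|x|^(n-2)].

   That the energy then decreases is an algebraic form of Coulson's integral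
   formula.  For [a > 0] and [|w| = 1] the polynomial
   [P = (1 + a X)^N - w (1 - a X)^N] has only imaginary zeros, so comparing
   monic [f] and [g] of the same degree on the imaginary axis compares the
   products of [|P|] over the zeros of [f] and of [g].  Taking [N]-th roots as
   [N] grows turns [|P(z)|] into [max |1 +- a z|], whose square is
   [1 + 2 a |Re z| + a^2 |z|^2]; the terms of first order in [a] then compare
   the sums of the [|Re z|]. *)

Lemma prodr_const_seq (R : pzSemiRingType) (T : Type) (s : seq T) (x : R) :
  \prod_(i <- s) x = x ^+ size s.
Proof. by rewrite big_const_seq count_predT iter_mulr_1. Qed.

Section WeierstrassProducts.

Variables (R : numDomainType) (T : Type).
Implicit Types (s t : seq T) (f g : T -> R).

Lemma le_1Dsum_prod1D s f :
  (forall i, 0 <= f i) -> 1 + \sum_(i <- s) f i <= \prod_(i <- s) (1 + f i).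
Proof.
move=> f0; elim: s => [|i s IHs]; first by rewrite !big_nil addr0.
rewrite !big_cons; set F := \sum_(j <- s) f j in IHs *.
have F0 : 0 <= F by rewrite sumr_ge0.
apply: le_trans (ler_wpM2l (addr_ge0 ler01 (f0 i)) IHs).
have -> : (1 + f i) * (1 + F) = 1 + (f i + F) + f i * F by ring.
by rewrite lerDl mulr_ge0.
Qed.

Lemma prod1D_mul_1Bsum_le1 s f :
  (forall i, 0 <= f i) ->
  \prod_(i <- s) (1 + f i) * (1 - \sum_(i <- s) f i) <= 1.
Proof.
move=> f0; elim: s => [|i s IHs]; first by rewrite !big_nil subr0 mulr1.
rewrite !big_cons; set F := \sum_(j <- s) f j in IHs *.
have F0 : 0 <= F by rewrite sumr_ge0.
apply: le_trans IHs; rewrite mulrAC [leLHS]mulrC ler_wpM2l //.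
  by rewrite prodr_ge0 // => j _; rewrite addr_ge0.
have -> : (1 + f i) * (1 - (f i + F)) = 1 - F - (f i ^+ 2 + f i * F) by ring.
by rewrite gerBl addr_ge0 ?mulr_ge0 ?exprn_ge0.
Qed.

Lemma le_sum_prod1D s t f g :
  (forall i, 0 <= f i) -> (forall i, 0 <= g i) ->
  \prod_(i <- s) (1 + f i) <= \prod_(i <- t) (1 + g i) ->
  \sum_(i <- s) f i <= (\sum_(i <- t) g i) * (1 + \sum_(i <- s) f i).
Proof.
move=> f0 g0 le_prod; set F := \sum_(i <- s) f i; set G := \sum_(i <- t) g i.
have F0 : 0 <= F by rewrite sumr_ge0.
have G0 : 0 <= G by rewrite sumr_ge0.
suff le1 : (1 + F) * (1 - G) <= 1.
  rewrite -subr_ge0; have -> : G * (1 + F) - F = 1 - (1 + F) * (1 - G) by ring.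
  by rewrite subr_ge0.
have [G1 | /ltW G1] := real_leP (ger0_real G0) (real1 R); last first.
  by apply: le_trans ler01; rewrite mulr_ge0_le0 ?addr_ge0 // subr_le0.
apply: le_trans (prod1D_mul_1Bsum_le1 t g0); rewrite ler_wpM2r ?subr_ge0 //.
exact: le_trans (le_1Dsum_prod1D s f0) le_prod.
Qed.

End WeierstrassProducts.

Lemma ler_second_order (F : numFieldType) (x y b c : F) :
  0 <= x -> 0 <= y -> 0 <= b -> 0 <= c ->
  (forall a, 0 < a -> a <= 1 ->
     a * x + a ^+ 2 * b <= (a * y + a ^+ 2 * c) * (1 + (a * x + a ^+ 2 * b))) ->
  x <= y.
Proof.
move=> x0 y0 b0 c0 le_xy; apply/ler_addgt0Pr => e e0.
pose d := c + (x + b) * (y + c).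
have d0 : 0 <= d by rewrite addr_ge0 ?mulr_ge0 ?addr_ge0.
have ed0 : 0 < e + d by rewrite ltr_wpDr.
have [a [a0 a1 ad]] : exists a, [/\ 0 < a, a <= 1 & a * d <= e].
  exists (e / (e + d)); split; first by rewrite divr_gt0.
    by rewrite ler_pdivrMr // mul1r lerDl.
  by rewrite mulrAC ler_pdivrMr // ler_pM2l // lerDr ltW.
have a_ge0 := ltW a0.
apply: le_trans (_ : x <= y + a * d) _; last by rewrite lerD2l.
rewrite -(ler_pM2l a0); apply: le_trans (_ : _ <= a * x + a ^+ 2 * b) _.
  by rewrite lerDl mulr_ge0 ?exprn_ge0.
apply: le_trans (le_xy a a0 a1) _; rewrite -subr_ge0.
have -> : a * (y + a * d) - (a * y + a ^+ 2 * c) * (1 + (a * x + a ^+ 2 * b)) =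
    a ^+ 2 * (1 - a) * (y * b + c * x + (1 + a) * (c * b)) by rewrite /d; ring.
by rewrite ?(mulr_ge0, subr_ge0, addr_ge0, exprn_ge0).
Qed.

Lemma bernoulli_le (R : numDomainType) (x : R) (n : nat) :
  0 <= x -> 1 + x *+ n <= (1 + x) ^+ n.
Proof.
move=> x0; have := le_1Dsum_prod1D (iota 0 n) (fun _ => x0).
by rewrite prodr_const_seq big_const_seq iter_addr_0 count_predT size_iota.
Qed.

(* Bernoulli's inequality makes [(x / y) ^+ N] unbounded when [y < x]. *)
Lemma ler_expr_bound (R : archiNumFieldType) (x y c : R) :
  0 <= x -> 0 <= y -> 0 <= c ->
  (forall N : nat, (0 < N)%N -> x ^+ N <= c * y ^+ N) -> x <= y.
Proof.
move=> x0 y0 c0 xy; rewrite real_leNgt ?ger0_real //; apply/negP => yx.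
have y_gt0 : 0 < y.
  rewrite lt_def y0 andbT; apply: contraTneq (xy 1%N isT) => y_eq0.
  by rewrite !expr1 y_eq0 mulr0 lt_geF // -y_eq0.
pose d := x / y - 1; have d0 : 0 < d by rewrite subr_gt0 ltr_pdivlMr ?mul1r.
have cd0 : 0 <= c / d by rewrite divr_ge0 // ltW.
have := archi_boundP cd0; set N := Num.Def.archi_bound _ => cdN.
have N0 : (0 < N)%N by rewrite -(ltr0n R) (le_lt_trans cd0).
suff : (1 + d) ^+ N <= c.
  have d1_ge0 : 0 <= 1 + d := addr_ge0 ler01 (ltW d0).
  apply/negP; rewrite -real_ltNge ?ger0_real ?exprn_ge0 //.
  apply: lt_le_trans (bernoulli_le N (ltW d0)).
  by rewrite ltr_wpDl // -mulr_natl -ltr_pdivrMr.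
by rewrite /d subrKC expr_div_n ler_pdivrMr ?exprn_gt0 ?xy.
Qed.

Section UnitCircle.

Variable C : numClosedFieldType.
Implicit Types (w : C) (p : {poly C}).

(* Writing [p(w) = e(w ^ 2) + w o(w ^ 2)], the value [e(w ^ 2)] is the mean of
   [p(w)] and [p(-w)], which reduces the claim to [e], of half the size. *)
Lemma exists_unimodular_horner0_le p :
  exists2 w, `|w| = 1 & `|p.[0]| <= `|p.[w]|.
Proof.
have [m] := ubnP (size p); elim: m p => // m IHm p /ltnSE sz_p.
have [/size1_polyC -> | sz_p2] := leqP (size p) 1.
  by exists 1; rewrite ?normr1 // !hornerC.
have sz_e : (size (even_poly p) < m)%N.
  apply: leq_ltn_trans (size_even_poly p) (leq_trans _ sz_p).
  case: (size p) sz_p2 => [|[|k]] //= _.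
  by rewrite !ltnS leq_uphalf_double -addnn leq_addr.
have [v v1 ev] := IHm _ sz_e; have sqr_v := sqrtCK v; set w := sqrtC v in sqr_v.
have w1 : `|w| = 1.
  by apply/eqP; rewrite -(@pexpr_eq1 _ _ 2) // -normrX sqr_v v1.
have p0 : p.[0] = (even_poly p).[0].
  by rewrite !horner_coef0 coef_even_poly.
have pE y : y ^+ 2 = v ->
    p.[y] = (even_poly p).[v] + (odd_poly p).[v] * y.
  move=> yv; rewrite -{1}(poly_even_odd p).
  by rewrite !hornerE !horner_comp !hornerE yv.
have mean : p.[w] + p.[- w] = (even_poly p).[v] *+ 2.
  by rewrite !pE ?sqrrN // mulrN addrACA subrr addr0.
have [|small] := real_leP (normr_real p.[0]) (normr_real p.[w]).
  by exists w.
exists (- w); rewrite ?normrN //.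
rewrite -(lerD2l `|p.[w]|) (le_trans _ (ler_normD _ _)) // mean normrMn mulr2n.
by rewrite lerD // ?p0 // (le_trans (ltW small)) ?p0.
Qed.

(* On the unit circle [|A - w B| = |B^* - w A^*|], so each factor may be
   arranged to have the larger of its two coefficients as constant term. *)
Lemma exists_unimodular_prod_max_le (T : Type) (s : seq T) (A B : T -> C) :
  exists2 w, `|w| = 1 &
    \prod_(i <- s) Num.max `|A i| `|B i| <= `|\prod_(i <- s) (A i - w * B i)|.
Proof.
pose c i := if `|A i| < `|B i| then (B i)^* else A i.
pose d i := if `|A i| < `|B i| then (A i)^* else B i.
pose p := \prod_(i <- s) ((c i)%:P - 'X * (d i)%:P).
have [w w1 pw] := exists_unimodular_horner0_le p.
exists w => //.
suff [<- <-] : `|p.[0]| = \prod_(i <- s) Num.max `|A i| `|B i| /\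
    `|p.[w]| = `|\prod_(i <- s) (A i - w * B i)| by [].
rewrite !horner_prod !normr_prod; split;
  apply: eq_bigr => i _; rewrite !hornerE.
  by rewrite subr0 /Order.max /c; case: ifP; rewrite ?norm_conjC.
rewrite /c /d; case: ifP => // _.
rewrite -[LHS]norm_conjC rmorphB rmorphM /= !conjCK.
by rewrite -[LHS]mul1r -w1 -normrM mulrBr mulrA -normCK w1 expr1n mul1r distrC.
Qed.

End UnitCircle.

Lemma ler_norm_prod_horner
    (C : numClosedFieldType) (p : {poly C}) (s t : seq C) :
  size s = size t ->
  (forall y, root p y ->
     `|\prod_(z <- t) (y - z)| <= `|\prod_(z <- s) (y - z)|) ->
  `|\prod_(z <- t) p.[z]| <= `|\prod_(z <- s) p.[z]|.
Proof.
move=> size_st ts; have [r pr] := closed_field_poly_normal p.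
have swap u : `|\prod_(z <- u) p.[z]| =
    `|lead_coef p| ^+ size u * \prod_(y <- r) `|\prod_(z <- u) (y - z)|.
  rewrite {1}pr normr_prod.
  under eq_bigr do rewrite hornerZ horner_prod normrM normr_prod.
  rewrite big_split prodr_const_seq exchange_big /=; congr (_ * _).
  apply: eq_bigr => y _; rewrite normr_prod.
  by apply: eq_bigr => z _; rewrite hornerXsubC distrC.
rewrite !swap size_st ler_wpM2l ?exprn_ge0 // big_seq [leRHS]big_seq.
apply: ler_prod => y yr; rewrite normr_ge0 ts //.
by rewrite pr rootE hornerZ (eqP (_ : root _ y)) ?mulr0 // root_prod_XsubC.
Qed.

Section InverseSums.

Variable F : numFieldType.
Implicit Types (a c K P X : F).

Lemma addV_gt2 a : 0 < a -> a != 1 -> 2 < a + a^-1.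
Proof.
move=> a0 a1; rewrite -subr_gt0.
have -> : a + a^-1 - 2 = (a - 1) ^+ 2 / a by field; rewrite gt_eqF.
rewrite divr_gt0 // real_exprn_even_gt0 ?subr_eq0 //.
by rewrite rpredB ?real1 ?gtr0_real.
Qed.

Lemma exists_mul_addV_le1 K :
  0 < K -> exists2 c, 1 < c & K * (c + c^-1 - 2) <= 1.
Proof.
move=> K0; have KV0 : 0 < K^-1 by rewrite invr_gt0.
exists (1 + K^-1); rewrite ?ltrDl //.
have -> : K * (1 + K^-1 + (1 + K^-1)^-1 - 2) = K^-1 / (1 + K^-1).
  by field; rewrite !gt_eqF ?addr_gt0.
by rewrite ler_pdivrMr ?addr_gt0 // mul1r lerDr.
Qed.

Lemma mul_XnD_le P X c (m d D : nat) :
  0 <= X -> 0 < c -> (d <= D)%N -> (m <= D)%N ->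
  P * (c + c^-1 - 2) <= Num.max 1 X ^+ m ->
  P * ((X ^+ D + c) * (X ^+ D + c^-1)) <= (P + X ^+ d) * (X ^+ D + 1) ^+ 2.
Proof.
move=> X0 c0 dD mD le_max; have XD0 : 0 <= X ^+ D by rewrite exprn_ge0.
have -> : (X ^+ D + c) * (X ^+ D + c^-1) =
    (X ^+ D + 1) ^+ 2 + (c + c^-1 - 2) * X ^+ D by field; rewrite gt_eqF.
rewrite mulrDr [leRHS]mulrDl lerD2l mulrA (le_trans (ler_wpM2r XD0 le_max)) //.
have [X1|/ltW X1] := real_leP (ger0_real X0) (real1 F).
  rewrite expr1n mul1r (le_trans (ler_wiXn2l X0 X1 dD)) //.
  by rewrite ler_peMr ?exprn_ge0 // exprn_ege1 // lerDr.
apply: le_trans (_ : _ <= 1 * (X ^+ D) ^+ 2) _.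
  by rewrite mul1r expr2 ler_wpM2r // ler_weXn2l.
by rewrite ler_pM ?exprn_ege1 ?exprn_ge0 // lerXn2r ?nnegrE ?addr_ge0 // lerDl.
Qed.

End InverseSums.

Lemma exprCi_double (C : numClosedFieldType) (k : nat) :
  'i ^+ k.*2 = (-1) ^+ k :> C.
Proof. by rewrite -mul2n exprM sqrCi. Qed.

Section CayleyMax.

Variable C : numClosedFieldType.
Implicit Types (a w z : C).

Definition cayley_max a z : C := Num.max `|1 + a * z| `|1 - a * z|.

Lemma cayley_max_ge0 a z : 0 <= cayley_max a z.
Proof. by rewrite /cayley_max /Order.max; case: ifP. Qed.

Lemma prod_cayley_max_ge0 a (s : seq C) : 0 <= \prod_(z <- s) cayley_max a z.
Proof. by apply: prodr_ge0 => z _; apply: cayley_max_ge0. Qed.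

Lemma norm1D_le_cayley_max a z : `|1 + a * z| <= cayley_max a z.
Proof. by rewrite comparable_le_max ?lexx // real_comparable ?normr_real. Qed.

Lemma norm1B_le_cayley_max a z : `|1 - a * z| <= cayley_max a z.
Proof.
by rewrite comparable_le_max ?lexx ?orbT // real_comparable ?normr_real.
Qed.

Lemma cayley_maxN a z : cayley_max a (- z) = cayley_max a z.
Proof.
rewrite /cayley_max mulrN opprK comparable_maxC //.
by rewrite real_comparable ?normr_real.
Qed.

Lemma expr_cayley_max a z N :
  cayley_max a z ^+ N = Num.max `|(1 + a * z) ^+ N| `|(1 - a * z) ^+ N|.
Proof.
rewrite /cayley_max !normrX.
have := real_leVge (normr_real (1 + a * z)) (normr_real (1 - a * z)).
case/orP=> le_norm.
  by rewrite !max_r // lerXn2r ?nnegrE.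
by rewrite !max_l // lerXn2r ?nnegrE.
Qed.

Lemma sqr_norm1D a z : a \is Num.real ->
  `|1 + a * z| ^+ 2 = 1 + (a * (2 * 'Re z) + a ^+ 2 * `|z| ^+ 2).
Proof.
move=> aR; rewrite !normCK ReE [2 * _]mulrC divfK ?pnatr_eq0 //.
by rewrite rmorphD rmorphM rmorph1 /= (conj_Creal aR); ring.
Qed.

Lemma sqr_norm1B a z : a \is Num.real ->
  `|1 - a * z| ^+ 2 = 1 + (- (a * (2 * 'Re z)) + a ^+ 2 * `|z| ^+ 2).
Proof. by move=> aR; rewrite -mulrN sqr_norm1D // raddfN normrN !mulrN. Qed.

Lemma sqr_cayley_max a z : 0 <= a ->
  cayley_max a z ^+ 2 = 1 + (a * (2 * `|'Re z|) + a ^+ 2 * `|z| ^+ 2).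
Proof.
move=> a0; have aR := ger0_real a0.
wlog Re_z : z / 0 <= 'Re z => [sqr_Re_ge0|].
  have /orP[|Re_z] := real_leVge (real0 C) (Creal_Re z).
    exact: sqr_Re_ge0.
  by rewrite -cayley_maxN sqr_Re_ge0 raddfN ?oppr_ge0 // !normrN.
rewrite /cayley_max max_l; first by rewrite sqr_norm1D // (ger0_norm Re_z).
rewrite -ler_sqr ?nnegrE // sqr_norm1D // sqr_norm1B // lerD2l lerD2r.
by rewrite ge0_cp ?mulr_ge0.
Qed.

Lemma eq_norm_cayley_Re0 a z :
  0 < a -> `|1 + a * z| = `|1 - a * z| -> 'Re z = 0.
Proof.
move=> a0 /(congr1 (fun x => x ^+ 2)); have aR := gtr0_real a0.
rewrite sqr_norm1D // sqr_norm1B // => /addrI/addIr/eqP.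
rewrite -addr_eq0 -mulr2n mulrn_eq0 !mulf_eq0 pnatr_eq0 /= gt_eqF //=.
by move/eqP.
Qed.

Definition cayley_poly a w N : {poly C} :=
  (1 + a%:P * 'X) ^+ N - w%:P * (1 - a%:P * 'X) ^+ N.

Lemma horner_cayley_poly a w N z :
  (cayley_poly a w N).[z] = (1 + a * z) ^+ N - w * (1 - a * z) ^+ N.
Proof. by rewrite !(hornerE, horner_exp). Qed.

Lemma root_cayley_poly_Re0 a w N z :
  0 < a -> `|w| = 1 -> (0 < N)%N -> root (cayley_poly a w N) z -> 'Re z = 0.
Proof.
move=> a0 w1 N0; rewrite rootE horner_cayley_poly subr_eq0.
move=> /eqP/(congr1 Num.norm); rewrite normrM w1 mul1r !normrX => /eqP.
rewrite eqrXn2 // => /eqP.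
exact: eq_norm_cayley_Re0.
Qed.

Lemma norm_horner_cayley_poly_le a w N z : `|w| = 1 ->
  `|(cayley_poly a w N).[z]| <= 2 * cayley_max a z ^+ N.
Proof.
move=> w1; rewrite horner_cayley_poly (le_trans (ler_normB _ _)) //.
rewrite normrM w1 mul1r !normrX mulr_natl mulr2n lerD // lerXn2r ?nnegrE //.
- exact: cayley_max_ge0.
- exact: norm1D_le_cayley_max.
- exact: cayley_max_ge0.
- exact: norm1B_le_cayley_max.
Qed.

End CayleyMax.

Section ImaginaryAxis.

Variable C : numClosedFieldType.
Implicit Types (a c x z : C) (r s t : seq C).

Definition energy s : C := \sum_(z <- s) `|'Re z|.

(* The modulus at [i x] of the monic polynomial with zeros [s]. *)
Definition imag_norm s x : C := `|\prod_(z <- s) ('i * x - z)|.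

Lemma energy_ge0 s : 0 <= energy s.
Proof. exact: sumr_ge0. Qed.

Lemma energy_cat s t : energy (s ++ t) = energy s + energy t.
Proof. exact: big_cat. Qed.

Lemma energy_scale c s : 0 <= c -> energy [seq c * z | z <- s] = c * energy s.
Proof.
move=> c0; rewrite /energy big_map mulr_sumr; apply: eq_bigr => z _.
by rewrite ReMl ?ger0_real // normrM (ger0_norm c0).
Qed.

Lemma energy_gt0 s :
  s != [::] -> (forall x, x \is Num.real -> imag_norm s x != 0) -> 0 < energy s.
Proof.
case: s => // z s _ /(_ ('Im z) (Creal_Im z)).
rewrite /imag_norm big_cons normrM mulf_eq0 negb_or => /andP[norm_z _].
rewrite /energy big_cons ltr_wpDr ?energy_ge0 // normr_gt0.
apply: contraNneq norm_z => Re_z.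
by rewrite {2}[z]Crect Re_z add0r subrr normr0.
Qed.

Lemma imag_norm_cat s t x :
  imag_norm (s ++ t) x = imag_norm s x * imag_norm t x.
Proof. by rewrite /imag_norm big_cat normrM. Qed.

Lemma imag_norm_scale c s x : 0 < c ->
  imag_norm [seq c * z | z <- s] x = c ^+ size s * imag_norm s (x / c).
Proof.
move=> c0; have c_neq0 : c != 0 by rewrite gt_eqF.
rewrite /imag_norm big_map -[X in X ^+ _](gtr0_norm c0) -normrX -normrM.
rewrite -prodr_const_seq -big_split; congr `| _ |; apply: eq_bigr => z _ /=.
by rewrite mulrBr mulrCA [c * (x / c)]mulrC divfK.
Qed.

Lemma imag_norm_ubound s x :
  imag_norm s x <= \prod_(z <- s) (1 + `|z|) * Num.max 1 `|x| ^+ size s.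
Proof.
rewrite -prodr_const_seq -big_split /imag_norm normr_prod.
apply: ler_prod => z _; rewrite normr_ge0 (le_trans (ler_normB _ _)) //=.
rewrite normrM normCi mul1r mulrDl mul1r.
have cmp : 1 >=< `|x| by rewrite real_comparable ?normr_real.
by rewrite lerD ?ler_peMr ?comparable_le_max ?lexx ?orbT.
Qed.

Lemma exists_zeros_XnD1 (D : nat) : (0 < D)%N -> (4 %| D)%N ->
  exists2 r, size r = D &
    forall x, x \is Num.real -> imag_norm r x = `|x| ^+ D + 1.
Proof.
move=> D0 /dvdnP[k Dk].
have [r] := closed_field_poly_normal ('X^D - (-1)%:P : {poly C}).
rewrite (monicP _) ?monicXnsubC // scale1r => rE; exists r.
  by apply/eqP; rewrite -eqSS -(size_prod_XsubC r id) -rE size_XnsubC.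
move=> x xR; have -> : imag_norm r x = `|('i * x) ^+ D + 1|.
  have /(congr1 (fun q => q.['i * x])) := rE.
  rewrite horner_prod !hornerE opprK => ->.
  by rewrite /imag_norm; under [in RHS]eq_bigr do rewrite hornerXsubC.
have D_double : D = k.*2.*2 by rewrite Dk -!muln2 -mulnA.
have xD0 : 0 <= x ^+ D by rewrite real_exprn_even_ge0 // D_double odd_double.
have iD : 'i ^+ D = 1 :> C.
  by rewrite D_double exprCi_double -signr_odd odd_double.
by rewrite exprMn iD mul1r -normrX (ger0_norm xD0) ger0_norm ?addr_ge0.
Qed.

Lemma imag_norm_scale_XnD1 (D : nat) r a x :
  size r = D -> (forall y, y \is Num.real -> imag_norm r y = `|y| ^+ D + 1) ->
  0 < a -> x \is Num.real ->
  imag_norm [seq a * z | z <- r] x = `|x| ^+ D + a ^+ D.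
Proof.
move=> size_r rE a0 xR.
have xaR : x / a \is Num.real by rewrite realM ?realV ?(gtr0_real a0).
rewrite imag_norm_scale // rE // size_r.
rewrite normf_div (gtr0_norm a0) expr_div_n mulrDr mulr1 mulrC.
by rewrite divfK ?expf_neq0 ?gt_eqF.
Qed.

Lemma imag_norm_cat_scale_le (d D : nat) r s t a x :
  size r = D -> (forall y, y \is Num.real -> imag_norm r y = `|y| ^+ D + 1) ->
  (size t <= D)%N -> (d <= D)%N -> 0 < a ->
  \prod_(z <- t) (1 + `|z|) * (a ^+ D + (a ^+ D)^-1 - 2) <= 1 ->
  x \is Num.real -> imag_norm t x + `|x| ^+ d <= imag_norm s x ->
  imag_norm (t ++ [seq a * z | z <- r] ++ [seq a^-1 * z | z <- r]) x <=
  imag_norm (s ++ r ++ r) x.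
Proof.
move=> size_r rE tD dD a0 aK xR gain.
have aD0 : 0 < a ^+ D by rewrite exprn_gt0.
have eta_ge0 : 0 <= a ^+ D + (a ^+ D)^-1 - 2.
  have [->|aD_neq1] := eqVneq (a ^+ D) 1.
    by rewrite invr1 -(natrD _ 1 1) subrr.
  by rewrite subr_ge0 ltW // addV_gt2.
have max_ge0 : 0 <= Num.max 1 `|x|.
  by rewrite comparable_le_max ?ler01 // real_comparable ?normr_real.
rewrite !imag_norm_cat !(imag_norm_scale_XnD1 size_r rE) ?invr_gt0 // !rE //.
rewrite exprVn -expr2; apply: le_trans (ler_wpM2r _ gain); last first.
  by rewrite exprn_ge0 // addr_ge0 ?exprn_ge0.
apply: (mul_XnD_le _ _ _ tD) => //.
apply: le_trans (ler_wpM2r eta_ge0 (imag_norm_ubound t x)) _.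
by rewrite mulrAC ler_piMl // exprn_ge0.
Qed.

End ImaginaryAxis.

Section EnergyComparison.

Variable C : archiClosedFieldType.
Implicit Types (a x z : C) (s t : seq C).

Lemma prod_cayley_max_le s t a :
  size s = size t -> 0 < a ->
  (forall x, x \is Num.real -> imag_norm t x <= imag_norm s x) ->
  \prod_(z <- t) cayley_max a z <= \prod_(z <- s) cayley_max a z.
Proof.
move=> size_st a0 le_ts; apply: (@ler_expr_bound _ _ _ (2 ^+ size s));
  rewrite ?exprn_ge0 ?prod_cayley_max_ge0 //.
move=> N N0; rewrite -!prodrXl.
under eq_bigr do rewrite expr_cayley_max.
have [w w1 lower] := exists_unimodular_prod_max_le t
  (fun z => (1 + a * z) ^+ N) (fun z => (1 - a * z) ^+ N).
apply: le_trans lower _; under eq_bigr do rewrite -horner_cayley_poly.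
apply: (@le_trans _ _ `|\prod_(z <- s) (cayley_poly a w N).[z]|).
  apply: ler_norm_prod_horner => // y /(root_cayley_poly_Re0 a0 w1 N0) Re_y.
  by rewrite [y]Crect Re_y add0r le_ts ?Creal_Im.
rewrite -prodr_const_seq -big_split normr_prod; apply: ler_prod => z _.
by rewrite normr_ge0 norm_horner_cayley_poly_le.
Qed.

Lemma energy_le s t :
  size s = size t ->
  (forall x, x \is Num.real -> imag_norm t x <= imag_norm s x) ->
  energy t <= energy s.
Proof.
move=> size_st le_ts.
have G_ge0 (r : seq C) : 0 <= \sum_(z <- r) `|z| ^+ 2.
  by apply: sumr_ge0 => z _; rewrite exprn_ge0.
rewrite -(ler_pM2l (ltr0Sn C 1)).
apply: (ler_second_order _ _ (G_ge0 t) (G_ge0 s));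
  rewrite ?mulr_ge0 ?energy_ge0 //.
move=> a a0 a1; pose u z := a * (2 * `|'Re z|) + a ^+ 2 * `|z| ^+ 2.
have u0 z : 0 <= u z by rewrite addr_ge0 ?mulr_ge0 ?exprn_ge0 ?(ltW a0).
have sumE r : a * (2 * energy r) + a ^+ 2 * (\sum_(z <- r) `|z| ^+ 2) =
    \sum_(z <- r) u z.
  by rewrite big_split -!mulr_sumr.
rewrite !sumE; apply: le_sum_prod1D => //.
have prodE r :
    \prod_(z <- r) (1 + u z) = (\prod_(z <- r) cayley_max a z) ^+ 2.
  by rewrite -prodrXl; apply: eq_bigr => z _; rewrite sqr_cayley_max ?(ltW a0).
by rewrite !prodE ler_sqr ?nnegrE ?prod_cayley_max_ge0 // prod_cayley_max_le.
Qed.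

(* The gain [|x| ^+ d] leaves room to multiply the two sides by
   [(x^D + 1)^2] and [(x^D + a^D) (x^D + a^-D)] for some [a > 1]; the zeros of
   the latter have the larger energy since [a + a^-1 > 2]. *)
Lemma energy_lt s t (d : nat) :
  size s = size t ->
  (forall x, x \is Num.real -> imag_norm t x + `|x| ^+ d <= imag_norm s x) ->
  energy t < energy s.
Proof.
move=> size_st gain; pose D := (4 * (size t + d).+1)%N.
have le_D m : (m <= size t + d)%N -> (m <= D)%N.
  by move=> le_m; rewrite /D mulnC (leq_trans _ (leq_pmulr _ _)) // leqW.
have [r size_r rE] :=
  exists_zeros_XnD1 C (isT : 0 < D)%N (dvdn_mulr _ (dvdnn 4)).
have r_gt0 : 0 < energy r.
  apply: energy_gt0 => [|x xR]; first by rewrite -size_eq0 size_r.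
  by rewrite rE // gt_eqF // ltr_wpDl ?exprn_ge0.
have K0 : 0 < \prod_(z <- t) (1 + `|z|).
  by apply: prodr_gt0 => z _; rewrite ltr_wpDr.
have [c c1 cK] := exists_mul_addV_le1 K0.
pose a := D.-root c; have aD : a ^+ D = c by rewrite rootCK.
have a1 : 1 < a by rewrite rootC_gt1.
have a0 : 0 < a := lt_trans ltr01 a1.
have aV0 : 0 < a^-1 by rewrite invr_gt0.
have le_energy :
    energy (t ++ [seq a * z | z <- r] ++ [seq a^-1 * z | z <- r]) <=
    energy (s ++ r ++ r).
  apply: energy_le => [|x xR]; first by rewrite !size_cat !size_map size_st.
  apply: (imag_norm_cat_scale_le size_r rE (le_D _ (leq_addr _ _))
    (le_D _ (leq_addl _ _)) a0 _ xR (gain x xR)).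
  by rewrite aD.
move: le_energy; rewrite !energy_cat !energy_scale ?(ltW a0) ?(ltW aV0) //.
rewrite -mulrDl -mulr2n -(ltrD2r (energy r *+ 2)); apply: lt_le_trans.
by rewrite ltrD2l -mulr_natl ltr_pM2r // addV_gt2 // gt_eqF.
Qed.

End EnergyComparison.

Section PermutationOrbits.

Variables (T : finType) (s : {perm T}).
Implicit Types (i x : T).

Lemma porbit_fixed x i : i \in porbit s x -> (s i == i) = (s x == x).
Proof.
case/porbitP => m ->.
by rewrite -permM -expgSr expgS permM (inj_eq perm_inj).
Qed.

Lemma porbit_fix1 x : s x = x -> porbit s x = [set x].
Proof.
move=> sx; apply/setP => i; rewrite inE; apply/porbitP/eqP => [[m ->]|->].
  by rewrite permX iter_fix.
by exists 0; rewrite expg0 perm1.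
Qed.

Lemma big_porbits (R : Type) (idx : R) (op : Monoid.com_law idx) (F : T -> R) :
  \big[op/idx]_i F i = \big[op/idx]_(X in porbits s) \big[op/idx]_(i in X) F i.
Proof.
rewrite (partition_big_imset (porbit s)) /=.
apply: eq_bigr => _ /imsetP[x _ ->].
by apply: eq_bigl => i; rewrite /= eq_porbit_mem.
Qed.

Lemma signr_perm_porbits (R : comPzRingType) :
  (-1) ^+ s = \prod_(X in porbits s) (-1) ^+ #|X|.+1 :> R.
Proof.
rewrite /odd_perm signr_addb !signr_odd -!prodr_const big_porbits -big_split.
by apply: eq_bigr => X _; rewrite prodr_const exprSr.
Qed.

End PermutationOrbits.

Section SignedCycles.

Variable n : nat.
Implicit Types (A B : 'M[int]_n) (s : {perm 'I_n}) (t : seq 'I_n).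
Implicit Types (i j x u v : 'I_n).

Lemma cyc_pairs_traject (f : 'I_n -> 'I_n) x k : iter k f x = x ->
  cyc_pairs (traject f x k) = [seq (i, f i) | i <- traject f x k].
Proof.
move=> fkx; have rot_f : rot 1 (traject f x k) = [seq f i | i <- traject f x k].
  case: k fkx => // k fkx.
  rewrite {1}trajectS rot1_cons -{2}fkx iterSr -trajectSr.
  by elim: k.+1 {fkx} x => //= m IHm y; rewrite IHm.
by rewrite /cyc_pairs rot_f -{1}[traject f x k]map_id zip_map.
Qed.

Lemma even_size_dcycle A t : bipartite_sd A -> dcycle A t -> ~~ odd (size t).
Proof.
move=> [c c_arc] /and3P[_ _ /allP arcs].
have size_rot1 : size t = size (rot 1 t) by rewrite size_rot.
have -> : odd (size t) = \big[addb/false]_(p <- cyc_pairs t) true.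
  rewrite big_const_seq count_predT size_zip -size_rot1 minnn.
  by elim: (size t) => //= k ->.
have -> : \big[addb/false]_(p <- cyc_pairs t) true =
    \big[addb/false]_(p <- cyc_pairs t) (c p.1 (+) c p.2).
  rewrite big_seq [RHS]big_seq; apply: eq_bigr => p /arcs/c_arc.
  by case: (c p.1); case: (c p.2).
rewrite big_split /= -(big_map fst xpredT c) -(big_map snd xpredT c).
rewrite [map fst _]unzip1_zip ?size_rot // [map snd _]unzip2_zip ?size_rot //.
rewrite (perm_big _ (_ : perm_eq (rot 1 t) t)) ?perm_rot //.
exact: (congr1 negb (addbb (\big[addb/false]_(i <- t) c i))).
Qed.

Lemma cycle_sign_Delta1 A t :
  Delta1 A -> dcycle A t -> cycle_sign A t = (-1) ^+ (size t)./2.+1.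
Proof.
move=> [_ [bip signs]] tA; have [sign0 sign2] := signs t tA.
have size_t := even_halfK (even_size_dcycle bip tA).
have size_mod4 : (size t %% 4 = (odd (size t)./2).*2)%N.
  by rewrite -{1}size_t -muln2 -(muln_modl 2 _ 2) modn2 muln2.
rewrite exprSr -signr_odd; case: odd size_mod4 => size_mod4.
  by rewrite sign2 ?size_mod4 // expr1 mulrNN mulr1.
by rewrite sign0 ?size_mod4 // mul1r.
Qed.

(* The nontrivial cycles of such a permutation form a linear subdigraph:
   vertex-disjoint directed cycles along arcs of [A]. *)
Definition arc_perm A s := [forall i, (s i != i) ==> sd_arc A i (s i)].

Definition nb_fixpoints s := #|[pred i | s i == i]|.

Lemma dcycle_porbit A s x : arc_perm A s -> s x != x ->
  dcycle A (traject s x #|porbit s x|).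
Proof.
move=> /forallP arc_s sx; set k := #|porbit s x|.
have k2 : (1 < k)%N.
  rewrite ltn_neqAle eq_sym lt0n card_porbit_neq0 andbT.
  apply: contra sx => /cards1P[y xE].
  have := porbit_id s x; have := mem_porbit s 1 x; rewrite xE !inE expg1.
  by move=> /eqP-> /eqP->.
rewrite /dcycle size_traject k2 uniq_traject_porbit.
rewrite cyc_pairs_traject ?iter_porbit // all_map.
apply/allP => i; rewrite -porbit_traject => i_x /=.
by apply: (implyP (arc_s i)); rewrite (porbit_fixed i_x).
Qed.

Lemma even_card_porbit A s x :
  bipartite_sd A -> arc_perm A s -> s x != x -> ~~ odd #|porbit s x|.
Proof.
move=> bip arc_s sx; rewrite -(size_traject s x #|porbit s x|).
exact: even_size_dcycle bip (dcycle_porbit arc_s sx).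
Qed.

Lemma prod_porbit_arcs A s x : Delta1 A -> arc_perm A s -> s x != x ->
  \prod_(i in porbit s x) A i (s i) = (-1) ^+ #|porbit s x|./2.+1.
Proof.
move=> dA arc_s sx; have := cycle_sign_Delta1 dA (dcycle_porbit arc_s sx).
rewrite size_traject => <-.
rewrite /cycle_sign cyc_pairs_traject ?iter_porbit // big_map.
by rewrite (eq_bigl _ _ (porbit_traject s x)) big_uniq ?uniq_traject_porbit //.
Qed.

Section DeterminantExpansion.

Variable C : numClosedFieldType.
Implicit Types (y : C).

Lemma porbit_contribution A s y (X : {set 'I_n}) :
  Delta1 A -> arc_perm A s -> X \in porbits s ->
  (-1) ^+ #|X|.+1 * \prod_(i in X) (('i * y) *+ (i == s i) - (A i (s i))%:~R) =
  \prod_(i in X) ('i * (if s i == i then y else 1)).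
Proof.
move=> dA arc_s /imsetP[x _ ->]; have [[_ A_diag] [bip _]] := dA.
have [sx|sx] := eqVneq (s x) x.
  rewrite porbit_fix1 // cards1 !big_set1 sx eqxx A_diag.
  by rewrite mulr1n subr0 sqrrN expr1n mul1r.
have moved i : i \in porbit s x -> (s i == i) = false.
  by move/porbit_fixed->; apply: negbTE.
rewrite (eq_bigr (fun i => - (A i (s i))%:~R)) => [|i /moved si]; last first.
  by rewrite eq_sym si sub0r.
rewrite [RHS](eq_bigr (fun=> 'i)) => [|i /moved ->]; last by rewrite mulr1.
have even_x := even_card_porbit bip arc_s sx.
have sgn1 : (-1) ^+ #|porbit s x| = 1 :> C.
  by rewrite -signr_odd (negPf even_x).
rewrite prodrN prodr_const exprS sgn1 mulr1 mul1r mulN1r -(rmorph_prod intr).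
rewrite (prod_porbit_arcs dA arc_s sx) rmorph_sign exprSr mulrN1 opprK.
by rewrite -[in RHS](even_halfK even_x) exprCi_double.
Qed.

Lemma char_poly_term A s y : Delta1 A ->
  (-1) ^+ s * \prod_i (('i * y) *+ (i == s i) - (A i (s i))%:~R) =
  if arc_perm A s then 'i ^+ n * y ^+ nb_fixpoints s else 0.
Proof.
move=> dA; case: ifPn => [arc_s|]; last first.
  rewrite negb_forall => /existsP[i]; rewrite negb_imply negbK.
  move=> /andP[si /eqP Ai].
  by rewrite (bigD1 i) //= Ai eq_sym (negPf si) subrr mul0r mulr0.
rewrite signr_perm_porbits (big_porbits s) -big_split /=.
rewrite (eq_bigr _ (fun X => porbit_contribution y dA arc_s)) -big_porbits.
by rewrite big_split /= prodr_const card_ord -big_mkcond prodr_const.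
Qed.

Lemma char_poly_imag A y : Delta1 A ->
  (char_poly (map_mx intr A)).['i * y] =
  'i ^+ n * \sum_(s | arc_perm A s) y ^+ nb_fixpoints s.
Proof.
move=> dA; rewrite -horner_evalE -det_map_mx /determinant mulr_sumr.
rewrite [RHS]big_mkcond /=.
apply: eq_bigr => s _; rewrite -char_poly_term //; congr (_ * _).
by apply: eq_bigr => i _; rewrite !mxE /horner_eval !hornerE hornerMn hornerX.
Qed.

Lemma norm_horner_intr_conj (p : {poly int}) z :
  `|(map_poly intr p).[z^*]| = `|(map_poly intr p).[z]| :> C.
Proof.
rewrite -[RHS]norm_conjC -horner_map -map_poly_comp; congr `| _.[_] |.
by apply: eq_map_poly => k; rewrite /= rmorph_int.
Qed.

Lemma norm_char_poly_imag A (x : C) : Delta1 A -> x \is Num.real ->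
  `|(char_poly (map_mx intr A)).['i * x]| =
  \sum_(s | arc_perm A s) `|x| ^+ nb_fixpoints s.
Proof.
move=> dA xR; transitivity `|(char_poly (map_mx intr A)).['i * `|x|]|.
  have /orP[x0|x0] := real_leVge (real0 C) xR.
    by rewrite (ger0_norm x0).
  rewrite -map_char_poly -norm_horner_intr_conj rmorphM /= conjCi.
  by rewrite (conj_Creal xR) (ler0_norm x0) mulrN mulNr.
rewrite char_poly_imag // normrM normrX normCi expr1n mul1r ger0_norm //.
by rewrite sumr_ge0 // => s _; rewrite exprn_ge0.
Qed.

End DeterminantExpansion.

Lemma imag_norm_sd_eigenvalues A (x : algC) :
  imag_norm (sd_eigenvalues A) x = `|(char_poly (map_mx intr A)).['i * x]|.
Proof.
rewrite /imag_norm /sd_eigenvalues; case: closed_field_poly_normal => r /= rE.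
rewrite [in RHS]rE (monicP (char_poly_monic _)) scale1r horner_prod.
by under [in RHS]eq_bigr do rewrite hornerXsubC.
Qed.

Lemma size_sd_eigenvalues A : size (sd_eigenvalues A) = n.
Proof.
rewrite /sd_eigenvalues; case: closed_field_poly_normal => r /= rE.
move: rE; rewrite (monicP (char_poly_monic _)) scale1r => rE.
by apply/eqP; rewrite -eqSS -(size_prod_XsubC r id) -rE size_char_poly.
Qed.

Definition sub_sidigraph B A := forall i j, sd_arc B i j -> B i j = A i j.

Lemma sub_sidigraph_arc B A i j :
  sub_sidigraph B A -> sd_arc B i j -> sd_arc A i j.
Proof. by move=> BA Bij; rewrite /sd_arc -(BA i j Bij). Qed.

Lemma sub_arc_perm B A s : sub_sidigraph B A -> arc_perm B s -> arc_perm A s.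
Proof.
move=> BA /forallP arc_s; apply/forallP => i; apply/implyP => si.
exact: sub_sidigraph_arc BA (implyP (arc_s i) si).
Qed.

Lemma Delta1_sub B A : sub_sidigraph B A -> Delta1 A -> Delta1 B.
Proof.
move=> BA [[A_entry A_diag] [[c c_arc] signs]].
have entry i j : B i j = 0 \/ B i j = A i j.
  by have [|/BA] := eqVneq (B i j) 0; [left|right].
split; [split=> [i j|i]|split=> [|t tB]].
- by have [->|->] := entry i j; rewrite ?A_entry // !inE eqxx orbT.
- by case: (entry i i) => ->.
- by exists c => i j /(sub_sidigraph_arc BA)/c_arc.
- have /and3P[t2 t_uniq /allP arcs] := tB.
  have -> : cycle_sign B t = cycle_sign A t.
    by rewrite /cycle_sign big_seq [RHS]big_seq; apply: eq_bigr => p /arcs/BA.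
  apply: signs; rewrite /dcycle t2 t_uniq.
  by apply/allP => p /arcs; apply: sub_sidigraph_arc.
Qed.

Lemma sd_energy_lt B A s : sub_sidigraph B A -> Delta1 A ->
  arc_perm A s -> ~~ arc_perm B s -> sd_energy B < sd_energy A.
Proof.
move=> BA dA sA sB; have dB := Delta1_sub BA dA.
apply: (@energy_lt _ _ _ (nb_fixpoints s)) => [|x xR].
  by rewrite !size_sd_eigenvalues.
rewrite !imag_norm_sd_eigenvalues !norm_char_poly_imag //.
rewrite addrC (bigD1 _ sA) /= lerD2l.
rewrite [leLHS]big_mkcond [leRHS]big_mkcond; apply: ler_sum => t _.
case: ifP => [tB|_]; last by case: ifP; rewrite ?exprn_ge0.
by rewrite ifT // (sub_arc_perm BA tB); apply: contraNneq sB => <-.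
Qed.

Lemma sub_delete_arc A u v : sub_sidigraph (delete_arc A u v) A.
Proof. by move=> i j; rewrite /sd_arc mxE; case: ifP => //; rewrite eqxx. Qed.

Lemma sd_arc_delete_arc A u v : sd_arc (delete_arc A u v) u v = false.
Proof. by rewrite /sd_arc mxE !eqxx. Qed.

Lemma arc_perm_tperm A u v : u != v ->
  arc_perm A (tperm u v) = sd_arc A u v && sd_arc A v u.
Proof.
move=> uv; apply/forallP/andP => [arcs|[Auv Avu] i]; last first.
  by case: tpermP => [->|->|]; rewrite ?eqxx ?Auv ?Avu ?implybT.
by have := arcs v; have := arcs u; rewrite tpermL tpermR [v == u]eq_sym uv.
Qed.

End SignedCycles.

Theorem theorem3p5 (n : nat) (A : 'M[int]_n) (u v : 'I_n) :
  Delta1 A -> sd_arc A u v -> sd_arc A v u ->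
  sd_energy (delete_arc A u v) < sd_energy A.
Proof.
move=> dA Auv Avu; have uv : u != v.
  apply: contraTneq Auv => ->.
  by case: dA => -[_ A_diag] _; rewrite /sd_arc A_diag.
apply: (sd_energy_lt (s := tperm u v) (@sub_delete_arc _ _ u v) dA).
- by rewrite arc_perm_tperm // Auv Avu.
- by rewrite arc_perm_tperm // sd_arc_delete_arc.
Qed.
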